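(* Let $A$ be a unital commutative $\mathbb{R}$-algebra. Suppose $K\subseteq\mathcal{X}(A)$ is compact and $B\subseteq A$ is a linear subspace such that there exists $q\in B$ with $\hat q$ strictly positive on $K$. Then for every $K$-positive linear functional $L:B\to\mathbb{R}$ there exists a positive Radon measure $\mu$ on $\mathcal{X}(A)$ supported in $K$ such that $L(b)=\int\hat b\,d\mu$ for all $b\in B$.
   Context: $\mathcal{X}(A)$ is the set of all $\mathbb{R}$-algebra homomorphisms $A\to\mathbb{R}$ (the character space), assumed nonempty throughout. For $a\in A$, $\hat a:\mathcal{X}(A)\to\mathbb{R}$ is $\hat a(\alpha)=\alpha(a)$; $\mathcal{X}(A)$ carries the weakest topology making all $\hat a$ continuous, and its Borel $\sigma$-algebra. For a Borel set $K\subseteq\mathcal{X}(A)$, a Radon measure $\mu$ is supported in $K$ if $\mu(M)=0$ for every Borel $M\subseteq\mathcal{X}(A)$ with $M\cap K=\emptyset$. A linear functional $L:B\to\mathbb{R}$ on a linear subspace $B\subseteq A$ is $K$-positive if $L(b)\ge0$ for every $b\in B$ such that $\hat b(\alpha)\ge0$ for all $\alpha\in K$. *)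

(* Defs.v *)
From HB Require Import structures.
From mathcomp Require Import all_boot all_order all_algebra.
From mathcomp Require Import all_classical all_reals all_analysis.

Set Implicit Arguments.
Unset Strict Implicit.
Unset Printing Implicit Defensive.

Import Order.TTheory GRing.Theory Num.Theory.
Import numFieldTopology.Exports numFieldNormedType.Exports.

Local Open Scope classical_set_scope.
Local Open Scope ring_scope.

Section CharacterSpace.
Context {R : realType} (A : comAlgType R).

Definition algebra_hom : Type := {lrmorphism A -> R | *%R}.

HB.instance Definition _ := gen_eqMixin algebra_hom.
HB.instance Definition _ := gen_choiceMixin algebra_hom.

Definition eval_at (a : A) (alpha : algebra_hom) : R := alpha a.

(* The supremum of the initial topologies of the evaluations, i.e., the weakest
   topology making all of them continuous. *)
Definition character_space : Type :=
  sup_topology (fun a : A => Topological.on (initial_topology (eval_at a))).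

HB.instance Definition _ := Topological.on character_space.

Definition hat (a : A) (alpha : character_space) : R := eval_at a alpha.

End CharacterSpace.

Section BorelSpace.
Context {T : topologicalType}.

(* Measurable types must be pointed; the point comes from nonemptiness, and
   neither the topology nor the sigma-algebra depends on it. *)
Definition pointed_at (T_nonempty : [set: T] !=set0) : Type := T.

HB.instance Definition _ T_nonempty := Topological.on (pointed_at T_nonempty).
HB.instance Definition _ T_nonempty :=
  isPointed.Build (pointed_at T_nonempty) (sval (cid T_nonempty)).

Definition borel_space (T_nonempty : [set: T] !=set0) : Type :=
  g_sigma_algebraType (@open (pointed_at T_nonempty)).

HB.instance Definition _ T_nonempty := Measurable.on (borel_space T_nonempty).

Context {R : realType} {T_nonempty : [set: T] !=set0}.
Variable mu : {measure set (borel_space T_nonempty) -> \bar R}.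
Local Open Scope ereal_scope.

Definition locally_finite := forall x : T,
  exists U : set T, [/\ open U, U x & mu U < +oo].

(* In a Hausdorff space (such as a character space) compact sets are closed, so
   that [measurable C] below is redundant. *)
Definition inner_regular := forall M : set (borel_space T_nonempty),
  measurable M ->
  mu M = ereal_sup [set mu C | C in
           [set C : set (borel_space T_nonempty) |
             [/\ @compact T C, measurable C & C `<=` M]]].

Definition radon_measure := locally_finite /\ inner_regular.

Definition supported_in (K : set T) :=
  forall M : set (borel_space T_nonempty),
    measurable M -> M `&` K = set0 -> mu M = 0.

End BorelSpace.

Section Subspace.
Context {R : realType} {A : lmodType R} (B : submodClosed A).

(* [B] is a bool-valued predicate; classically these are arbitrary linear
   subspaces of [A], of any dimension. *)
Record subspace_type :=
  SubspaceElt { subspace_val : A ; subspace_valP : subspace_val \in B }.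

HB.instance Definition _ := [isSub for subspace_val].
HB.instance Definition _ := [Choice of subspace_type by <:].
HB.instance Definition _ := [SubChoice_isSubLmodule of subspace_type by <:].

End Subspace.

Definition K_positive {R : realType} {A : comAlgType R}
    (K : set (character_space A)) (B : submodClosed A)
    (L : {scalar subspace_type B}) : Prop :=
  forall b : subspace_type B,
    (forall alpha, K alpha -> 0 <= hat (\val b) alpha) -> 0 <= L b.

(* Main.v *)
Require Import Defs.
From HB Require Import structures.
From mathcomp Require Import all_boot all_order all_algebra.
From mathcomp Require Import all_classical all_reals all_analysis.
From mathcomp Require Import measurable_realfun.
From mathcomp Require Import lra.

Set Implicit Arguments.
Unset Strict Implicit.
Unset Printing Implicit Defensive.

Import Order.TTheory GRing.Theory Num.Theory.
Import numFieldTopology.Exports numFieldNormedType.Exports.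

Local Open Scope classical_set_scope.
Local Open Scope ring_scope.

(** The functions [hat b], for [b] in [B], are continuous and hence bounded on
the compact set [K], and [hat q] is bounded below on [K] by a constant [c > 0].
So every function [f] that is bounded on [K] lies, on [K], below some multiple
of [hat q], and [f |-> inf {L b | f <= hat b on K}] is a sublinear functional.
The Hahn-Banach theorem ([hahn_banach]) gives a linear functional below it;
this is a positive functional [Lam] on all functions bounded on [K], continuous
or not, and [Lam (hat b) = L b] ([positive_extension]). Positivity shows at the
same time that [L b] only depends on the restriction of [hat b] to [K].

It remains to represent [Lam] on continuous functions by a Radon measure
([riesz_representation]). As [Lam] is defined on indicator functions,
[nu A = Lam 1_A] is a finitely additive content on all sets. Put
[m U = sup {nu C | C compact, C included in U and K}] for open [U], and let
[mu E] be the infimum of [m U] over the open [U] containing [E]. A compact set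
covered by open sets [U_i] is covered by finitely many closed sets, each meeting
it inside one of the [U_i] ([compact_cover_shrink]), so [m] is countably
subadditive and [mu] is an outer measure. Open sets are Caratheodory measurable
([open_caratheodory]), which makes [mu] a Borel measure; it is Radon, vanishes
off [K], satisfies [mu K = nu K] and [nu C <= mu C] for [C] compact in [K].

These comparisons identify the integral without any partition of unity.
If [f >= 0] is continuous and [G_i = {x in K | i + 1 <= f x}], then
[f <= 1 + sum_i 1_(G_i)] and [sum_i 1_(G_i) <= f] on [K]. Hence
[Lam f <= nu K + sum_i nu G_i <= nu K + sum_i mu G_i <= nu K + int_K f dmu]
([functional_le_integral1]). Applying this to [n * f] and dividing by [n]
removes the term [nu K]; adding a constant removes the assumption [f >= 0];
exchanging [f] and [- f] gives equality. *)

(** * The Hahn-Banach theorem *)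

Section HahnBanach.
Context {R : realType} {V : lmodType R}.
Implicit Types p q : V -> R.

(** Sublinear functionals. The inequality for scaling suffices: with
    subadditivity it forces [p 0 = 0], and [p (t *: x) = t * p x] for
    [0 <= t]. *)
Definition sublinear p :=
  (forall x y, p (x + y) <= p x + p y) /\
  (forall t x, 0 <= t -> p (t *: x) <= t * p x).

Lemma sublinear0 p : sublinear p -> p 0 = 0.
Proof.
move=> [pD pZ]; apply/le_anti/andP; split.
  by have := pZ 0 0 (lexx 0); rewrite scale0r mul0r.
by have := pD 0 0; rewrite addr0; lra.
Qed.

Lemma sublinearN_ge p x : sublinear p -> - p (- x) <= p x.
Proof.
move=> sp; have := sp.1 x (- x); rewrite subrr sublinear0//; lra.
Qed.

(** The pointwise infimum of a chain of sublinear functionals below [p] is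
    finite, because each of them is at least [- p (- x)] at [x], and it is
    sublinear. *)
Lemma sublinear_chain_inf p (A : set (V -> R)) :
    A !=set0 -> (forall q, A q -> sublinear q /\ forall x, q x <= p x) ->
    (forall q q', A q -> A q' ->
      (forall x, q x <= q' x) \/ (forall x, q' x <= q x)) ->
  exists2 g, sublinear g & forall q, A q -> forall x, g x <= q x.
Proof.
move=> [q0 Aq0] Ap Atot.
have lbA x : has_lbound [set q x | q in A].
  exists (- p (- x)) => _ [q Aq <-].
  by have [sq qp] := Ap q Aq; have := sublinearN_ge x sq; have := qp (- x); lra.
have gA q : A q -> forall x, inf [set q x | q in A] <= q x.
  by move=> Aq x; apply: ge_inf => //; exists q.
exists (fun x => inf [set q x | q in A]) => //; split=> [x y|t x t0].
  rewrite -lerBlDr; apply: lb_le_inf; first by exists (q0 x), q0.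
  move=> _ [q1 Aq1 <-]; rewrite lerBlDl -lerBlDr.
  apply: lb_le_inf; first by exists (q0 y), q0.
  move=> _ [q2 Aq2 <-]; rewrite lerBlDr [leRHS]addrC.
  (* By totality the smaller of [q1] and [q2] serves at both points. *)
  have [q [Aq q1q q2q]] : exists q, [/\ A q, q x <= q1 x & q y <= q2 y].
    by have [h|h] := Atot _ _ Aq1 Aq2; [exists q1|exists q2].
  have := gA q Aq (x + y); have := (Ap q Aq).1.1 x y; lra.
have [->|tn0] := eqVneq t 0.
  rewrite scale0r mul0r; apply: (le_trans (gA _ Aq0 0)).
  by rewrite sublinear0//; exact: (Ap _ Aq0).1.
have t_gt0 : 0 < t by rewrite lt_def tn0.
rewrite -ler_pdivrMl//; apply: lb_le_inf; first by exists (q0 x), q0.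
move=> _ [q Aq <-]; rewrite ler_pdivrMl//; apply: (le_trans (gA q Aq _)).
exact: (Ap q Aq).1.2.
Qed.

Lemma sublinear_minimal p : sublinear p -> exists q,
  [/\ sublinear q, forall x, q x <= p x &
      forall r, sublinear r -> (forall x, r x <= q x) -> r = q].
Proof.
move=> sp; pose S := {q : V -> R | sublinear q /\ forall x, q x <= p x}.
pose below (q r : S) := `[< forall x, sval r x <= sval q x >].
have [| | | |[q [sq qp]] qmin] := @Zorn S below.
- by move=> q; apply/asboolP => x.
- move=> q r s /asboolP qr /asboolP rs; apply/asboolP => x.
  exact: le_trans (rs x) (qr x).
- move=> [q Sq] [r Sr] /asboolP/= qr /asboolP/= rq; apply: eq_exist => /=.
  by apply/funext => x; apply/le_anti/andP.
- move=> A Atot; have [[q0 Aq0]|A0] := pselect (A !=set0); last first.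
    exists (exist _ p (conj sp (fun x => lexx _))) => s As.
    by exfalso; apply: A0; exists s.
  have [||q q' [s As <-] [s' As' <-]|g sg gA] :=
      @sublinear_chain_inf p [set sval s | s in A].
  + by exists (sval q0), q0.
  + by move=> _ [s As <-]; exact: (svalP s).
  + by have [/asboolP|/asboolP] := Atot s s' As As'; [right|left].
  + have gp x : g x <= p x.
      by apply: (@le_trans _ _ (sval q0 x)); [apply: gA; exists q0|exact: (svalP q0).2].
    exists (exist _ g (conj sg gp)) => s As; apply/asboolP => x.
    by apply: gA; exists s.
exists q; split=> // r sr rq.
have rp x : r x <= p x by apply: le_trans (rq x) (qp x).
have := qmin (exist _ r (conj sr rp)).
by move=> /(_ _)/(congr1 sval); apply; exact/asboolP.
Qed.

(** A minimal sublinear functional is additive. Fixing [y], the functional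
    [z |-> inf {q (z + t *: y) - t * q y | t >= 0}] is sublinear and at most [q]
    (take [t = 0]), so it equals [q]; the value at [t = 1] then gives the
    inequality. *)
Lemma minimal_sublinear_superadd q :
    sublinear q ->
    (forall r, sublinear r -> (forall x, r x <= q x) -> r = q) ->
  forall x y, q x + q y <= q (x + y).
Proof.
move=> sq qmin x y; have [qD qZ] := sq.
pose E z := [set q (z + t *: y) - t * q y | t in [set t | 0 <= t]].
have E_lb z : has_lbound (E z).
  exists (- q (- z)) => _ [t t0 <-].
  have := qD (z + t *: y) (- z); rewrite addrAC subrr add0r => h1.
  have: q (t *: y) = t * q y.
    apply/le_anti; rewrite qZ//=; have [->|tn0] := eqVneq t 0.
      by rewrite mul0r scale0r sublinear0.
    have t_gt0 : 0 < t by rewrite lt_def tn0.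
    have := qZ t^-1 (t *: y); rewrite invr_ge0 => /(_ t0).
    by rewrite scalerA mulVf// scale1r ler_pdivlMl.
  lra.
have E0 z : E z !=set0 by exists (q (z + 0 *: y) - 0 * q y), 0 => //=.
have infE z t : 0 <= t -> inf (E z) <= q (z + t *: y) - t * q y.
  by move=> t0; apply: ge_inf => //; exists t.
have rq z : inf (E z) <= q z.
  by have := infE z 0 (lexx _); rewrite scale0r mul0r addr0 subr0.
have sr : sublinear (fun z => inf (E z)).
  split=> [z z'|s z s0].
    rewrite -lerBlDr; apply: lb_le_inf => // _ [t t0 <-].
    rewrite lerBlDl -lerBlDr; apply: lb_le_inf => // _ [t' t'0 <-].
    rewrite lerBlDr; apply: (le_trans (infE _ (t + t') _)); first exact: addr_ge0.
    have := qD (z + t *: y) (z' + t' *: y).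
    by rewrite scalerDl addrACA mulrDl; lra.
  have [->|sn0] := eqVneq s 0.
    by rewrite scale0r mul0r (le_trans (rq 0))// sublinear0.
  have s_gt0 : 0 < s by rewrite lt_def sn0.
  rewrite -ler_pdivrMl//; apply: lb_le_inf => // _ [t t0 <-].
  rewrite ler_pdivrMl//; apply: (le_trans (infE _ (s * t) _)).
    exact: mulr_ge0.
  by have := qZ s (z + t *: y) s0; rewrite scalerDr scalerA mulrBr mulrA; lra.
have /(congr1 (fun h => h x)) := qmin _ sr rq.
by have := infE x 1 ler01; rewrite scale1r mul1r => + /= e; rewrite e; lra.
Qed.

(** Applied to [p] that is constructed from a functional on a subspace, the
    conclusion [f <= p] forces [f] to extend that functional. *)
Lemma hahn_banach p : sublinear p ->
  exists f : {scalar V}, forall x, f x <= p x.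
Proof.
move=> /sublinear_minimal[f [sf fp fmin]].
have fD x y : f (x + y) = f x + f y.
  by apply/le_anti; rewrite sf.1 minimal_sublinear_superadd.
have fN x : f (- x) = - f x.
  by have := fD x (- x); rewrite subrr sublinear0//; lra.
have fZge0 t x : 0 <= t -> f (t *: x) = t * f x.
  move=> t0; apply/le_anti; rewrite sf.2//=.
  by have := sf.2 t (- x) t0; rewrite scalerN !fN; lra.
have fZ t x : f (t *: x) = t * f x.
  have [t0|t0] := leP 0 t; first exact: fZge0.
  have := fZge0 (- t) x; rewrite oppr_ge0 => /(_ (ltW t0)).
  by rewrite scaleNr fN; lra.
have flin : linear_for *%R f by move=> t x y; rewrite fD fZ.
pose h := GRing.isLinear.Build R V R *%R f flin.
by exists (HB.pack_for {scalar V} f h).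
Qed.

End HahnBanach.

(** * Extension of positive functionals *)

Section PositiveExtension.
Context {R : realType} {T : Type} (K : set T).
Implicit Types f g : T -> R.

(** Boundedness of [f] on [K]; the values outside [K] are irrelevant. *)
Definition bounded_on f := exists M : R, forall x, K x -> `|f x| <= M.

(** The same condition as a predicate, to form the subspace of the functions
    bounded on [K]. *)
Definition bounded_funs : {pred T -> R} := fun f => `[< bounded_on f >].

Lemma bounded_funsP f : reflect (bounded_on f) (f \in bounded_funs).
Proof. exact: asboolP. Qed.

Lemma bounded_funs_submod : submod_closed bounded_funs.
Proof.
split; first by apply/bounded_funsP; exists 0 => x _; rewrite normr0.
move=> a f g /bounded_funsP[M Mf] /bounded_funsP[N Ng].
apply/bounded_funsP; exists (`|a| * M + N) => x Kx.
rewrite (le_trans (ler_normD _ _))// lerD// ?Ng//.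
by rewrite normrM ler_wpM2l// Mf.
Qed.

HB.instance Definition _ :=
  GRing.isSubmodClosed.Build R (T -> R) bounded_funs bounded_funs_submod.

(** A positive linear functional on the functions bounded on [K]. It is encoded
    as a total map, which is unconstrained on the other functions. *)
Record positive_functional (Lam : (T -> R) -> R) : Prop := PositiveFunctional {
  pos_add : forall f g, bounded_on f -> bounded_on g ->
    Lam (fun x => f x + g x) = Lam f + Lam g ;
  pos_scale : forall c f, bounded_on f -> Lam (fun x => c * f x) = c * Lam f ;
  pos_ge0 : forall f, bounded_on f -> (forall x, K x -> 0 <= f x) -> 0 <= Lam f }.

(** M. Riesz extension: a positive functional [L] on a space [W] of functions
    bounded on [K] that contains a function bounded below by [c > 0] on [K]
    extends to all functions bounded on [K]. The map [e] realizes the elements of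
    [W] as functions and need not be injective. *)
Lemma positive_extension (W : lmodType R) (e : W -> T -> R) (L : {scalar W})
    (u : W) (c : R) :
    (forall w w' x, e (w + w') x = e w x + e w' x) ->
    (forall a w x, e (a *: w) x = a * e w x) ->
    (forall w, bounded_on (e w)) ->
    (forall w, (forall x, K x -> 0 <= e w x) -> 0 <= L w) ->
    0 < c -> (forall x, K x -> c <= e u x) ->
  exists2 Lam, positive_functional Lam & forall w, Lam (e w) = L w.
Proof.
move=> eD eZ e_bd Lpos c0 cu.
have e0 x : e 0 x = 0 by rewrite -(scale0r (0 : W)) eZ mul0r.
have eN w x : e (- w) x = - e w x by rewrite -scaleN1r eZ mulN1r.
have Lmono w w' : (forall x, K x -> e w x <= e w' x) -> L w <= L w'.
  move=> ww'; rewrite -subr_ge0 -linearB; apply: Lpos => x Kx.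
  by rewrite eD eN subr_ge0 ww'.
pose V : lmodType R := subspace_type bounded_funs.
pose E (f : V) := [set L w | w in [set w | forall x, K x -> \val f x <= e w x]].
have bdV (f : V) : bounded_on (\val f) by exact/bounded_funsP/valP.
have E0 (f : V) : E f !=set0.
  have [M fM] := bdV f; exists (L ((M / c) *: u)), ((M / c) *: u) => // x Kx.
  have M0 : 0 <= M by apply: le_trans (fM x Kx).
  rewrite (le_trans (ler_norm _))// (le_trans (fM x Kx))// eZ.
  by rewrite -mulrA ler_peMr// mulrC ler_pdivlMr// mul1r cu.
have Elb (f : V) : has_lbound (E f).
  have [M fM] := bdV f; exists (L ((- (M / c)) *: u)) => _ [w fw <-].
  apply: Lmono => x Kx; rewrite eZ mulNr.
  have M0 : 0 <= M by apply: le_trans (fM x Kx).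
  apply: le_trans (fw x Kx); rewrite lerNl (le_trans (ler_norm _))// normrN.
  rewrite (le_trans (fM x Kx))//.
  by rewrite -mulrA ler_peMr// mulrC ler_pdivlMr// mul1r cu.
have infE (f : V) w : (forall x, K x -> \val f x <= e w x) -> inf (E f) <= L w.
  by move=> fw; apply: ge_inf => //; exists w.
have sE : sublinear (fun f : V => inf (E f)).
  split=> [f g|t f t0].
    rewrite -lerBlDr; apply: lb_le_inf => // _ [w fw <-].
    rewrite lerBlDl -lerBlDr; apply: lb_le_inf => // _ [w' gw' <-].
    rewrite lerBlDr -linearD; apply: infE => x Kx.
    by rewrite addrC eD lerD// ?fw ?gw'.
  have [->|tn0] := eqVneq t 0.
    rewrite scale0r mul0r -(linear0 L); apply: infE => x Kx.
    by rewrite e0.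
  have t_gt0 : 0 < t by rewrite lt_def tn0.
  rewrite -ler_pdivrMl//; apply: lb_le_inf => // _ [w fw <-].
  rewrite ler_pdivrMl// -scalarZ ; apply: infE => x Kx.
  by rewrite eZ ler_pM2l// fw.
have [F FE] := hahn_banach sE.
have Fpos (f : V) : (forall x, K x -> 0 <= \val f x) -> 0 <= F f.
  move=> f0; rewrite -oppr_le0 -linearN -(linear0 L).
  apply: (le_trans (FE _)); apply: infE => x Kx.
  by rewrite e0 oppr_le0 f0.
pose mkV f (bf : bounded_on f) : V := Sub f (introT (bounded_funsP f) bf).
pose Lam f := if pselect (bounded_on f) is left bf then F (mkV f bf) else 0.
have LamE f (v : V) : \val v = f -> Lam f = F v.
  move=> vf; have bf : bounded_on f by rewrite -vf.
  rewrite /Lam; case: pselect => // bf'; congr (F _); apply: val_inj.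
  by rewrite vf SubK.
exists Lam; first split.
- move=> f g bf bg; rewrite (@LamE f (mkV f bf))// (@LamE g (mkV g bg))//.
  by rewrite -linearD; apply: LamE.
- move=> a f bf; rewrite (@LamE f (mkV f bf))// -scalarZ.
  by apply: LamE.
- by move=> f bf f0; rewrite (@LamE f (mkV f bf))//; exact: Fpos.
- move=> w; rewrite (@LamE _ (mkV _ (e_bd w)))//.
  apply/le_anti/andP; split; first by apply: (le_trans (FE _)); exact: infE.
  rewrite -lerN2 -!linearN; apply: (le_trans (FE _)); apply: infE => x Kx.
  by rewrite eN.
Qed.

End PositiveExtension.

(** * Compact sets in Hausdorff spaces *)

Section CompactSets.
Context {T : topologicalType}.
Implicit Types (A B C U : set T) (P : set T -> Prop).

(** A property of sets that is inherited by subsets and finite unions holds for a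
    compact set if it holds locally: otherwise the sets [A] such that [P] holds
    for [C] minus [A] form a proper filter without cluster point in [C]. *)
Lemma compact_induction C P :
    compact C -> P set0 ->
    (forall A B, A `<=` B -> P B -> P A) ->
    (forall A B, P A -> P B -> P (A `|` B)) ->
    (forall x, C x -> exists2 N, nbhs x N & P (N `&` C)) ->
  P C.
Proof.
move=> cC P0 Psub PU Ploc; apply: contrapT => nPC.
pose F := [set A | P (C `\` A)].
have FF : Filter F.
  split; rewrite /F /=.
  - by rewrite setDT.
  - by move=> A B PA PB /=; rewrite setDIr; exact: PU.
  - by move=> A B AB; apply: Psub; exact: setDS.
have FP : ProperFilter F by split; rewrite /F/= ?setD0.
have [|x [Cx xF]] := cC F FP; first by rewrite /F/= setDv.
have [N xN PN] := Ploc x Cx.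
have [|y [+ Ny]] := xF (~` N) N _ xN; last by move=> /(_ Ny).
by rewrite /F/= setDE setCK setIC.
Qed.

(** Compact Hausdorff sets are regular; [C] need not be a neighborhood of [x] in
    the ambient space. *)
Lemma compact_closed_nbhs C U x :
    hausdorff_space T -> compact C -> open U -> U x ->
  exists F, [/\ closed F, nbhs x F & F `&` C `<=` U].
Proof.
move=> hT cC oU Ux.
have cD : compact (C `\` U).
  by rewrite setDE; apply: compact_closedI => //; exact: open_closedC.
(* Separate [x] from the compact set [C `\` U]. *)
suff [N [xN clN]] : exists N, nbhs x N /\ closure N `&` (C `\` U) `<=` set0.
  exists (closure N); split; first exact: closed_closure.
    by apply: filterS xN; exact: subset_closure.
  by move=> y [Ny Cy]; apply: contrapT => Uy; exact: (clN y).
apply: (@compact_induction _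
  (fun A => exists N, nbhs x N /\ closure N `&` A `<=` set0)) => //.
- by exists setT; split; [exact: filterT|rewrite setI0].
- move=> A B AB [N [xN NB]]; exists N; split=> //.
  by apply: subset_trans NB; exact: setIS.
- move=> A B [N [xN NA]] [M [xM MB]]; exists (N `&` M); split.
    exact: filterI.
  move=> y [/closureI[Ny My] [Ay|By]]; first exact: (NA y).
  exact: (MB y).
- move=> y [Cy Uy].
  have /eqP xy : x <> y by move=> xy; apply: Uy; rewrite -xy.
  move: hT; rewrite open_hausdorff => /(_ _ _ xy)[[N M] /= [Nx My]].
  rewrite !inE in Nx My => -[oN oM /eqP NM0].
  exists M; first exact: open_nbhs_nbhs.
  exists N; split; first exact: open_nbhs_nbhs.
  move=> z [Nz [Mz _]]; have [w ] := Nz M (open_nbhs_nbhs (conj oM Mz)).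
  by rewrite NM0.
Qed.

(** The closed sets [F i `&` C] are compact, and each lies in the corresponding
    open set; only finitely many are needed. *)
Lemma compact_cover_shrink C (U : (set T)^nat) :
    hausdorff_space T -> compact C -> (forall i, open (U i)) ->
    C `<=` \bigcup_i U i ->
  exists n (F : (set T)^nat),
    [/\ forall i, closed (F i), forall i, F i `&` C `<=` U i &
        C `<=` \big[setU/set0]_(i < n) F i].
Proof.
move=> hT cC oU CU.
apply: (@compact_induction _ (fun A => exists n (F : (set T)^nat),
    [/\ forall i, closed (F i), forall i, F i `&` C `<=` U i &
        A `<=` \big[setU/set0]_(i < n) F i])) => //.
- by exists 0%N, (fun=> set0); split=> // i /=; [exact: closed0|rewrite set0I].
- move=> A B AB [n [F [cF FU BF]]]; exists n, F; split=> //.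
  exact: subset_trans BF.
- move=> A B [n [F [cF FU AF]]] [m [G [cG GU BG]]].
  exists (n + m)%N, (fun i => F i `|` G i); split=> [i|i|].
  + exact: closedU.
  + by rewrite setIUl subUset; split; [exact: FU|exact: GU].
  + rewrite -(bigcup_mkord _ (fun i => F i `|` G i)).
    rewrite -bigcup_mkord in AF; rewrite -bigcup_mkord in BG.
    move=> x [Ax|Bx].
      have [i /= ni Fx] := AF x Ax; exists i; last by left.
      exact: leq_trans (leq_addr _ _).
    have [i /= mi Gx] := BG x Bx; exists i; last by right.
    exact: leq_trans (leq_addl _ _).
- move=> x Cx; have [i _ Uix] := CU x Cx.
  have [F [cF xF FU]] := compact_closed_nbhs hT cC (oU i) Uix.
  exists F => //; exists i.+1, (fun j => if j == i then F else set0); split.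
  + by move=> j; case: ifP => // _; exact: closed0.
  + by move=> j; case: eqP => [->//|_]; rewrite set0I.
  + rewrite -(bigcup_mkord _ (fun j => if j == i then F else set0)).
    move=> y [Fy _]; exists i => //=.
    by rewrite eqxx.
Qed.

End CompactSets.

(** * The outer measure of a finitely additive content *)

Section InnerContent.
Local Open Scope ereal_scope.
Context {R : realType} {T : topologicalType}.
Hypothesis hT : hausdorff_space T.
Variables (K : set T) (nu : set T -> R).
Hypothesis nu_ge0 : forall A, (0 <= nu A)%R.
Hypothesis nu_add : forall A B, A `&` B = set0 -> nu (A `|` B) = (nu A + nu B)%R.

Lemma content0 : nu set0 = 0%R.
Proof. by have := nu_add (set0I set0); rewrite setU0; lra. Qed.

Lemma content_le A B : A `<=` B -> (nu A <= nu B)%R.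
Proof.
move=> AB; rewrite -(setUIDK B A) (setIidr AB) nu_add ?lerDl//.
by rewrite setDIK.
Qed.

Lemma content_subadd A B : (nu (A `|` B) <= nu A + nu B)%R.
Proof.
have -> : A `|` B = A `|` (B `\` A).
  apply/seteqP; split=> x [Ax|]; [by left| |by left|by move=> [Bx _]; right].
  by move=> Bx; have [Ax|Ax] := pselect (A x); [left|right].
by rewrite nu_add ?setDIK// lerD2l content_le.
Qed.

Lemma content_bigsetU (F : (set T)^nat) n :
  (nu (\big[setU/set0]_(i < n) F i) <= \sum_(i < n) nu (F i))%R.
Proof.
elim: n => [|n ih]; first by rewrite !big_ord0 content0.
rewrite !big_ord_recr/= (le_trans (content_subadd _ _))//.
by rewrite lerD2r.
Qed.

(** The content of an open set, approximated from inside by compact subsets of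
    [K]. *)
Definition inner_content (U : set T) : \bar R :=
  ereal_sup [set (nu C)%:E | C in [set C | compact C /\ C `<=` U `&` K]].

(** The extension of [inner_content] to all sets, by approximation from outside
    by open sets. *)
Definition outer_content (E : set T) : \bar R :=
  ereal_inf [set inner_content U | U in [set U | open U /\ E `<=` U]].

Lemma inner_content_ge C U : compact C -> C `<=` U `&` K ->
  (nu C)%:E <= inner_content U.
Proof. by move=> cC CU; apply: ereal_sup_ubound; exists C. Qed.

Lemma inner_content_ge0 U : 0 <= inner_content U.
Proof.
by have := inner_content_ge compact0 (@sub0set _ (U `&` K)); rewrite content0.
Qed.

Lemma inner_content_le U V : U `<=` V -> inner_content U <= inner_content V.
Proof.
move=> UV; apply: ge_ereal_sup => _ [C [cC CU] <-].
by apply: inner_content_ge => //; apply: subset_trans CU _; exact: setSI.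
Qed.

Lemma inner_content_total U : inner_content U <= (nu K)%:E.
Proof.
apply: ge_ereal_sup => _ [C [cC CU] <-]; rewrite lee_fin content_le//.
by apply: subset_trans CU _; exact: subIsetr.
Qed.

Lemma inner_content_disjoint U : U `&` K = set0 -> inner_content U = 0.
Proof.
move=> UK; apply/le_anti; rewrite inner_content_ge0 andbT.
apply: ge_ereal_sup => _ [C [cC CUK] <-].
by move: CUK; rewrite UK subset0 => ->; rewrite content0.
Qed.

Lemma outer_content_open U : open U -> outer_content U = inner_content U.
Proof.
move=> oU; apply/le_anti/andP; split.
  by apply: ereal_inf_lbound; exists U => //; split.
by apply: le_ereal_inf_tmp => _ [V [oV UV] <-]; exact: inner_content_le.
Qed.

Lemma outer_content_ge0 E : 0 <= outer_content E.
Proof. by apply: le_ereal_inf_tmp => _ [V [oV UV] <-]; exact: inner_content_ge0. Qed.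

Lemma outer_content_le E F : E `<=` F -> outer_content E <= outer_content F.
Proof.
move=> EF; apply: le_ereal_inf_tmp => _ [V [oV FV] <-].
by apply: ereal_inf_lbound; exists V => //; split=> //; exact: subset_trans FV.
Qed.

Lemma outer_content_total E : outer_content E <= (nu K)%:E.
Proof.
apply: le_trans (inner_content_total setT); apply: ereal_inf_lbound.
by exists setT => //; split => //; exact: openT.
Qed.

Lemma outer_content_fin E : outer_content E \is a fin_num.
Proof.
rewrite ge0_fin_numE ?outer_content_ge0//.
by rewrite (le_lt_trans (outer_content_total E))// ltry.
Qed.

Lemma outer_content_compact C : compact C -> C `<=` K ->
  (nu C)%:E <= outer_content C.
Proof.
move=> cC CK; apply: le_ereal_inf_tmp => _ [V [oV CV] <-].
by apply: inner_content_ge => // x Cx; split; [exact: CV|exact: CK].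
Qed.

Lemma inner_content_bigcup (U : (set T)^nat) : (forall i, open (U i)) ->
  inner_content (\bigcup_i U i) <= \sum_(i <oo) inner_content (U i).
Proof.
move=> oU; apply: ge_ereal_sup => _ [C [cC CU] <-].
have CK : C `<=` K by move=> x /CU[].
have [|n [F [cF FU CF]]] := compact_cover_shrink hT cC oU.
  by move=> x /CU[].
apply: (@le_trans _ _ (\sum_(0 <= i < n) inner_content (U i))); last first.
  by apply: nneseries_lim_ge => i _ _; exact: inner_content_ge0.
rewrite big_mkord.
apply: (@le_trans _ _ (\sum_(i < n) (nu (F i `&` C))%:E)); last first.
  apply: lee_sum => i _; apply: inner_content_ge.
    by rewrite setIC; exact: compact_closedI.
  by move=> x FCx; split; [exact: (FU i)|exact/CK/FCx.2].
rewrite sumEFin lee_fin; apply: le_trans (content_bigsetU (fun i => F i `&` C) n).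
apply: content_le => x Cx; have := CF x Cx.
by rewrite -bigcup_mkord -(bigcup_mkord _ (fun i => F i `&` C)) => -[i ni Fx];
  exists i.
Qed.

Lemma outer_content_sigma_subadditive : sigma_subadditive outer_content.
Proof.
move=> A.
suff add2e (e : {posnum R}) :
    outer_content (\bigcup_n A n) <=
    \sum_(i <oo) outer_content (A i) + e%:num%:E.
  by apply/lee_addgt0Pr => _/posnumP[].
rewrite (le_trans _ (epsilon_trick _ _ _))//; last first.
  by move=> n; exact: outer_content_ge0.
(* Open sets that approximate [A n] up to [e / 2 ^ (n + 1)]. *)
have [U UP] : {U : (set T)^nat & forall n, [/\ open (U n), A n `<=` U n &
    inner_content (U n) <= outer_content (A n) + (e%:num / (2 ^ n.+1)%:R)%:E]}.
  apply: (@choice _ _ (fun n U => [/\ open U, A n `<=` U &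
    inner_content U <= outer_content (A n) + (e%:num / (2 ^ n.+1)%:R)%:E])) => n.
  have en : (0 < e%:num / (2 ^ n.+1)%:R)%R by [].
  have [_ [U [oU AU] <-] h] := lb_ereal_inf_adherent en (outer_content_fin (A n)).
  by exists U; split => //; exact: ltW.
have oU i : open (U i) by have [] := UP i.
apply: (@le_trans _ _ (inner_content (\bigcup_n U n))).
  apply: ereal_inf_lbound; exists (\bigcup_n U n) => //; split.
    exact: bigcup_open.
  by apply: subset_bigcup => i _; have [] := UP i.
apply: (le_trans (inner_content_bigcup oU)).
by apply: lee_nneseries => [*|i *]; [exact: inner_content_ge0|have [] := UP i].
Qed.

Lemma outer_content0 : outer_content set0 = 0.
Proof.
by rewrite outer_content_open ?inner_content_disjoint ?set0I//; exact: open0.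
Qed.

(** [outer_content] bundled as an outer measure. *)
Definition content_outer_measure : {outer_measure set T -> \bar R} :=
  HB.pack_for {outer_measure set T -> \bar R} outer_content
    (isOuterMeasure.Build R T outer_content outer_content0 outer_content_ge0
      outer_content_le outer_content_sigma_subadditive).

Lemma open_caratheodory U : open U -> outer_content.-caratheodory U.
Proof.
move=> oU; apply: (@le_caratheodory_measurable _ _ content_outer_measure) => X /=.
apply: le_ereal_inf_tmp => _ [W [oW XW] <-].
have XUW : outer_content (X `&` U) <= inner_content (W `&` U).
  rewrite -outer_content_open; last exact: openI.
  by apply: outer_content_le; exact: setSI.
apply: (le_trans (leeD2r _ XUW)).
rewrite -leeBrDr ?outer_content_fin//; apply: ge_ereal_sup => _ [C [cC CWU] <-].
rewrite leeBrDr ?outer_content_fin// addeC -leeBrDr//.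
(* A compact [C] in [W `&` U] is disjoint from the compact subsets of the open
   set [W `\` C], so their contents add up to at most that of [W]. *)
have oWC : open (W `\` C).
  by rewrite setDE; apply: openI => //; apply: closed_openC; exact: compact_closed.
apply: (@le_trans _ _ (inner_content (W `\` C))).
  rewrite -outer_content_open//; apply: outer_content_le => x [Xx Ux].
  by split; [exact: XW|move=> /CWU[[_ /Ux]]].
apply: ge_ereal_sup => _ [D [cD DWC] <-].
rewrite leeBrDr// -EFinD -nu_add; last first.
  by apply/seteqP; split=> // x [/DWC[[_ nC] _]].
apply: inner_content_ge; first exact: compactU.
move=> x [/DWC[[]]//|/CWU[[]]//].
Qed.

End InnerContent.

(** * The Radon measure of a finitely additive content *)

Section BorelMeasure.
Local Open Scope ereal_scope.
Context {R : realType} {T : topologicalType}.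
Hypothesis hT : hausdorff_space T.
Variable T_nonempty : [set: T] !=set0.
Variables (K : set T) (nu : set T -> R).
Hypothesis cK : compact K.
Hypothesis nu_ge0 : forall A, (0 <= nu A)%R.
Hypothesis nu_add : forall A B, A `&` B = set0 -> nu (A `|` B) = (nu A + nu B)%R.

Let om : {outer_measure set T -> \bar R} :=
  content_outer_measure hT K nu_ge0 nu_add.

Lemma open_borel (U : set T) : open U -> measurable (U : set (borel_space T_nonempty)).
Proof. by move=> oU; exact: sub_sigma_algebra. Qed.

Lemma closed_borel (C : set T) : closed C -> measurable (C : set (borel_space T_nonempty)).
Proof.
move=> cC; rewrite -(setCK C); apply: measurableC; apply: open_borel.
exact: closed_openC.
Qed.

Lemma borel_caratheodory (A : set (borel_space T_nonempty)) :
  measurable A -> (outer_content K nu).-caratheodory A.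
Proof.
move: A; suff: <<s @open (pointed_at T_nonempty) >> `<=` om.-caratheodory by [].
apply: smallest_sub; last by move=> U; exact: open_caratheodory.
split.
- exact: (caratheodory_measurable_set0 om).
- by move=> A; rewrite setTD; exact: (@caratheodory_measurable_setC _ _ om).
- exact: (@caratheodory_measurable_bigcup _ _ om).
Qed.

Lemma borel_content_measure :
  exists mu : {measure set (borel_space T_nonempty) -> \bar R},
    forall A, mu A = outer_content K nu A.
Proof.
pose m : set (borel_space T_nonempty) -> \bar R := outer_content K nu.
have m0 : m set0 = 0 by exact: outer_content0.
have m_ge0 A : 0 <= m A by exact: outer_content_ge0.
have m_add : semi_sigma_additive m.
  move=> F mF tF mUF.
  apply: (@caratheodory_measure_sigma_additive _ (pointed_at T_nonempty) om) => //.
    by move=> i; exact/borel_caratheodory.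
  exact/borel_caratheodory.
pose mh := isMeasure.Build _ (borel_space T_nonempty) R m m0 m_ge0 m_add.
by exists (HB.pack_for {measure set (borel_space T_nonempty) -> \bar R} m mh).
Qed.

Variable mu : {measure set (borel_space T_nonempty) -> \bar R}.
Hypothesis muE : forall A, mu A = outer_content K nu A.

Lemma content_measure_fin A : mu A \is a fin_num.
Proof. by rewrite muE outer_content_fin. Qed.

Lemma content_measure_setC : mu (~` K) = 0.
Proof.
have oK : open (~` K) by apply: closed_openC; exact: compact_closed.
by rewrite muE outer_content_open// inner_content_disjoint// setICl.
Qed.

Lemma content_measure_compact C : compact C -> C `<=` K -> (nu C)%:E <= mu C.
Proof. by move=> *; rewrite muE outer_content_compact. Qed.

Lemma content_measure_K : mu K = (nu K)%:E.
Proof.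
apply/le_anti; rewrite content_measure_compact// andbT.
by rewrite muE outer_content_total.
Qed.

Lemma content_measure_supported : supported_in mu K.
Proof.
move=> M mM MK; apply: subset_measure0 content_measure_setC => //.
  apply: open_borel; apply: closed_openC; exact: compact_closed.
exact/disjoints_subset.
Qed.

Lemma content_measure_radon : radon_measure mu.
Proof.
split.
  move=> x; exists setT; split => //; first exact: openT.
  by rewrite -ge0_fin_numE// content_measure_fin.
move=> M mM; apply/le_anti/andP; split; last first.
  apply: ge_ereal_sup => _ [C [_ mC CM] <-].
  by apply: le_measure => //; rewrite inE.
apply/lee_addgt0Pr => e e0.
(* Outer approximation of [~` M] by [U] turns into inner approximation of [M] by
   the compact set [K `\` U]. *)
have [_ [U [oU MU] <-] Ue] :=
  lb_ereal_inf_adherent e0 (outer_content_fin K nu_ge0 nu_add (~` M)).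
have cC : compact (K `\` U).
  by rewrite setDE; apply: compact_closedI => //; exact: open_closedC.
have CM : mu (K `\` U) <=
    ereal_sup [set mu C | C in [set C : set (borel_space T_nonempty) |
             [/\ @compact T C, measurable C & C `<=` M]]].
  apply: ereal_sup_ubound; exists (K `\` U) => //; split=> //.
    by apply: closed_borel; exact: compact_closed.
  by move=> x [_ Ux]; apply: contrapT => /MU.
apply: le_trans (leeD2r _ CM).
have mKU : measurable (K `\` U : set (borel_space T_nonempty)).
  by apply: closed_borel; exact: compact_closed.
have mU : measurable (U : set (borel_space T_nonempty)) by exact: open_borel.
have mCK : measurable (~` K : set (borel_space T_nonempty)).
  by apply: open_borel; apply: closed_openC; exact: compact_closed.
have : mu setT <= mu (K `\` U) + mu U.
  have -> : [set: borel_space T_nonempty] = ((K `\` U) `|` U) `|` ~` K.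
    apply/seteqP; split => // x _.
    have [Kx|Kx] := pselect (K x); last by right.
    by left; have [Ux|Ux] := pselect (U x); [right|left].
  apply: le_trans (measureU2 mu _ _) _ => //; first exact: measurableU.
  by rewrite [X in _ + X]content_measure_setC adde0 measureU2.
have muU : mu U <= mu (~` M) + e%:E.
  by rewrite !muE outer_content_open// ltW.
rewrite -(setUv M) measureU//; [move=> h|exact: measurableC|exact: setICr].
 rewrite -(@leeD2rE _ (mu (~` M))) ?content_measure_fin//.
apply: (le_trans h); rewrite -addeA leeD2l//.
by rewrite addeC.
Qed.

End BorelMeasure.

(** * The Riesz representation *)

Section RieszRepresentation.
Context {R : realType} {T : topologicalType}.
Hypothesis hT : hausdorff_space T.
Variables (T_nonempty : [set: T] !=set0) (K : set T) (Lam : (T -> R) -> R).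
Hypothesis cK : compact K.
Hypothesis Lam_pos : positive_functional K Lam.

Lemma bounded_onD (f g : T -> R) :
  bounded_on K f -> bounded_on K g -> bounded_on K (fun x => f x + g x).
Proof.
move=> [M Mf] [N Ng]; exists (M + N) => x Kx.
by rewrite (le_trans (ler_normD _ _))// lerD ?Mf ?Ng.
Qed.

Lemma bounded_onM c (f : T -> R) :
  bounded_on K f -> bounded_on K (fun x => c * f x).
Proof.
move=> [M Mf]; exists (`|c| * M) => x Kx.
by rewrite normrM ler_wpM2l ?Mf.
Qed.

Lemma bounded_on_cst (c : R) : bounded_on K (fun=> c).
Proof. by exists `|c|. Qed.

Lemma bounded_on_indic (A : set T) : bounded_on K (\1_A : T -> R).
Proof.
by exists 1 => x _; rewrite indicE; case: (_ \in _); rewrite ?normr1 ?normr0.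
Qed.

Lemma bounded_on_sum (f : nat -> T -> R) n :
  (forall i, bounded_on K (f i)) -> bounded_on K (fun x => \sum_(i < n) f i x).
Proof.
move=> bf; elim: n => [|n ih].
  by under eq_fun do rewrite big_ord0; exact: bounded_on_cst.
by under eq_fun do rewrite big_ord_recr/=; exact: bounded_onD.
Qed.

Lemma bounded_on_continuous (f : T -> R) : continuous f -> bounded_on K f.
Proof.
move=> cf; have /compact_bounded : compact (f @` K).
  by apply: continuous_compact => //; exact: continuous_subspaceT.
by move=> /pinfty_ex_gt0[M _ fM]; exists M => x Kx; apply: fM; exists x.
Qed.

Lemma pos_le f g : bounded_on K f -> bounded_on K g ->
  (forall x, K x -> f x <= g x) -> Lam f <= Lam g.
Proof.
move=> bf bg fg; have bNf := bounded_onM (-1) bf.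
have := pos_ge0 Lam_pos (bounded_onD bg bNf).
rewrite (pos_add Lam_pos bg bNf) (pos_scale Lam_pos _ bf) mulN1r subr_ge0.
by apply=> x Kx; rewrite mulN1r subr_ge0 fg.
Qed.

Lemma pos_sum (f : nat -> T -> R) n : (forall i, bounded_on K (f i)) ->
  Lam (fun x => \sum_(i < n) f i x) = \sum_(i < n) Lam (f i).
Proof.
move=> bf; elim: n => [|n ih].
  rewrite big_ord0; under eq_fun do rewrite big_ord0.
  have := pos_scale Lam_pos 0 (bounded_on_cst 0).
  by rewrite /= !mul0r.
rewrite big_ord_recr/= -ih -(pos_add Lam_pos)//; last exact: bounded_on_sum.
by congr Lam; apply/funext => x; rewrite big_ord_recr.
Qed.

(** The finitely additive content given by the values on indicators. *)
Definition functional_content (A : set T) : R := Lam (\1_A).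
Local Notation nu := functional_content.

Lemma functional_content_ge0 A : 0 <= nu A.
Proof.
by apply: (pos_ge0 Lam_pos) => *; [exact: bounded_on_indic|rewrite indicE].
Qed.

Lemma functional_content_add A B : A `&` B = set0 ->
  nu (A `|` B) = nu A + nu B.
Proof.
move=> AB; rewrite /nu -(pos_add Lam_pos); [|exact: bounded_on_indic..].
congr Lam; apply/funext => x; rewrite !indicE in_setU.
have [xA|xA] := boolP (x \in A); have [xB|xB] := boolP (x \in B);
  rewrite ?addr0 ?add0r//.
have : (A `&` B) x by split; exact/set_mem.
by rewrite AB.
Qed.

(** The number of integers from 1 to [n] that are at most [y] is the integer part
    of [y] if [0 <= y <= n]; this lemma and the next are the resulting bounds. *)
Lemma level_sum_le (y : R) n : 0 <= y ->
  \sum_(i < n) (i.+1%:R <= y)%R%:R <= y.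
Proof.
move=> y0; suff : \sum_(i < n) (i.+1%:R <= y)%R%:R <= Num.min n%:R y.
  by rewrite le_min => /andP[].
elim: n => [|n ih]; first by rewrite big_ord0 le_min lexx y0.
rewrite big_ord_recr/=; move: ih; rewrite !le_min => /andP[h1 h2].
have [ny|ny] := boolP (n.+1%:R <= y).
  have h : \sum_(i < n) (i.+1%:R <= y)%R%:R + 1 <= n.+1%:R :> R.
    by rewrite -natr1 lerD2r.
  by rewrite h (le_trans h ny).
by rewrite addr0 h2 (le_trans h1)// ler_nat.
Qed.

Lemma le_level_sum (y : R) n : y <= n%:R ->
  y <= 1 + \sum_(i < n) (i.+1%:R <= y)%R%:R.
Proof.
elim: n => [y0|n ih yn].
  by rewrite big_ord0 addr0 (le_trans y0).
have [ny|ny] := leP y n%:R.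
  by rewrite big_ord_recr/= addrA (le_trans (ih ny))// lerDl.
rewrite big_ord_recr/= (eq_bigr (fun=> 1)) => [|i _]; last first.
  by rewrite (le_trans _ (ltW ny))// ler_nat.
rewrite sumr_const card_ord -natr1 in yn *.
by rewrite addrA (le_trans yn)// (addrC 1) lerDl.
Qed.

Lemma continuous_borel_measurable (f : T -> R) : continuous f ->
  measurable_fun setT (f : borel_space T_nonempty -> R).
Proof.
move=> cf; apply: (measurability _ (RGenOInfty.measurableE R)).
move=> _ [_ [x ->] <-]; rewrite setTI; apply: open_borel.
by apply: open_comp => //; exact: interval_open.
Qed.

Variable mu : {measure set (borel_space T_nonempty) -> \bar R}.
Hypothesis muE : forall A, mu A = outer_content K nu A.

Let measurable_K : measurable (K : set (borel_space T_nonempty)).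
Proof. by apply: closed_borel; exact: compact_closed. Qed.

Let mu_fin A : (mu A < +oo)%E.
Proof.
by rewrite -ge0_fin_numE// (content_measure_fin functional_content_ge0
  functional_content_add muE).
Qed.

Lemma bounded_integrable_K (f : T -> R) : bounded_on K f ->
  measurable_fun setT (f : borel_space T_nonempty -> R) ->
  mu.-integrable K (EFin \o f).
Proof.
move=> [M fM] mf; apply: measurable_bounded_integrable => //.
  exact: measurable_funTS.
exists M; split=> [|N MN x Kx]; first exact: num_real.
exact: le_trans (fM x Kx) (ltW MN).
Qed.

Lemma continuous_integrable_K (f : T -> R) : continuous f ->
  mu.-integrable K (EFin \o f).
Proof.
move=> cf; apply: bounded_integrable_K; first exact: bounded_on_continuous.
exact: continuous_borel_measurable.
Qed.

(** The layer-cake comparison with unit steps; the error [nu K] is removed in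
    [functional_le_integral_ge0] by scaling. *)
Lemma functional_le_integral1 (f : T -> R) :
    continuous f -> (forall x, K x -> 0 <= f x) ->
  Lam f <= nu K + \int[mu]_(x in K) f x.
Proof.
move=> cf f0; have bf := bounded_on_continuous cf; have [M fM] := bf.
pose n := (Num.bound M).
have fn x : K x -> f x <= n%:R.
  move=> Kx; rewrite (le_trans (ler_norm _))// (le_trans (fM x Kx))//.
  by apply/ltW/archi_boundP; exact: le_trans (fM x Kx).
pose G i := f @^-1` `[i.+1%:R, +oo[ `&` K.
have cG i : compact (G i).
  rewrite /G setIC; apply: compact_closedI => //.
  by apply: preimage_closed => //; exact: interval_closed.
have GE i x : K x -> \1_(G i) x = (i.+1%:R <= f x)%R%:R :> R.
  move=> Kx; rewrite indicE; congr (_%:R); congr nat_of_bool.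
  apply/idP/idP; first by move=> /set_mem[]; rewrite /= in_itv/= andbT.
  by move=> h; apply/mem_set; split => //=; rewrite in_itv/= h.
have mG i : measurable (G i : set (borel_space T_nonempty)).
  by apply: closed_borel; exact: compact_closed.
have bG i : bounded_on K (\1_(G i) : T -> R) by exact: bounded_on_indic.
have bK := bounded_on_indic K.
have bS := bounded_on_sum n bG.
have le1 : Lam f <= nu K + \sum_(i < n) nu (G i).
  rewrite -(@pos_sum (fun i => \1_(G i)))// -(pos_add Lam_pos)//.
  apply: pos_le => //; first exact: bounded_onD.
  move=> x Kx; rewrite indicE mem_set//.
  rewrite (eq_bigr (fun i : 'I_n => (i.+1%:R <= f x)%R%:R)) => [|i _]; last exact: GE.
  exact/le_level_sum/fn.
apply: (le_trans le1); rewrite lerD2l -lee_fin fineK; last first.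
  by apply: integrable_fin_num => //; exact: continuous_integrable_K.
apply: (@le_trans _ _ (\sum_(i < n) \int[mu]_(x in K) (\1_(G i) x)%:E)%E).
  rewrite -sumEFin; apply: lee_sum => i _; rewrite integral_indic//.
  rewrite setIidl; last by move=> x [].
  apply: (content_measure_compact muE) => //; by move=> x [].
rewrite -(ge0_integral_sum _ _
  (f := fun (i : 'I_n) (x : borel_space T_nonempty) => (\1_(G i) x)%:E))//=;
  last first.
  by move=> i; apply/measurable_EFinP; exact: measurable_indic.
apply: ge0_le_integral => //.
- by move=> x _; apply: sume_ge0.
- apply: emeasurable_sum => i; apply/measurable_EFinP; exact: measurable_indic.
- apply/measurable_EFinP/measurable_funTS; exact: continuous_borel_measurable.
- move=> x Kx; rewrite sumEFin lee_fin.
  rewrite (eq_bigr (fun i : 'I_n => (i.+1%:R <= f x)%R%:R)) => [|i _]; last exact: GE.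
  exact/level_sum_le/f0.
Qed.

Lemma functional_le_integral_ge0 (f : T -> R) :
    continuous f -> (forall x, K x -> 0 <= f x) ->
  Lam f <= \int[mu]_(x in K) f x.
Proof.
move=> cf f0; have bf := bounded_on_continuous cf.
have h (n : nat) : n%:R * Lam f <= nu K + n%:R * \int[mu]_(x in K) f x.
  rewrite -(pos_scale Lam_pos)// -RintegralZl//; last exact: continuous_integrable_K.
  apply: functional_le_integral1 => [x|x Kx]; last by rewrite mulr_ge0// f0.
  by apply: cvgM; [exact: cvg_cst|exact: cf].
rewrite leNgt; apply/negP; rewrite -subr_gt0 => d0.
set d := _ - _ in d0.
have := h (Num.bound (nu K / d)).
rewrite -lerBlDr -mulrBr -/d leNgt => /negP; apply.
rewrite -ltr_pdivrMr//; apply: archi_boundP.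
by rewrite divr_ge0 ?functional_content_ge0// ltW.
Qed.

Lemma functional_le_integral (f : T -> R) :
  continuous f -> Lam f <= \int[mu]_(x in K) f x.
Proof.
move=> cf; have bf := bounded_on_continuous cf; have [M fM] := bf.
have bM := bounded_on_cst M.
have /functional_le_integral_ge0 : continuous (fun x => f x + M).
  by move=> x; apply: cvgD; [exact: cf|exact: cvg_cst].
have f0 x : K x -> 0 <= f x + M.
  by move=> /fM; rewrite ler_norml => /andP[+ _]; rewrite -subr_ge0 opprK.
move=> /(_ f0); rewrite (pos_add Lam_pos)// RintegralD//; last 2 first.
- exact: continuous_integrable_K.
- by apply: bounded_integrable_K => //; exact: measurable_cst.
rewrite Rintegral_cst// (content_measure_K cK functional_content_ge0
  functional_content_add muE)/=.
suff -> : Lam (fun=> M) = M * nu K by rewrite lerD2r.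
rewrite /nu -(pos_scale Lam_pos)//; last exact: bounded_on_indic.
apply/le_anti/andP; split; apply: pos_le => //;
  try (apply: bounded_onM; exact: bounded_on_indic);
  by move=> x Kx; rewrite indicE mem_set// mulr1.
Qed.

Lemma functional_integralE (f : T -> R) :
  continuous f -> Lam f = \int[mu]_(x in K) f x.
Proof.
move=> cf; apply/le_anti/andP; split; first exact: functional_le_integral.
have /functional_le_integral : continuous (fun x => -1 * f x).
  by move=> x; apply: cvgM; [exact: cvg_cst|exact: cf].
rewrite (pos_scale Lam_pos); last exact: bounded_on_continuous.
by rewrite RintegralZl ?mulN1r ?lerN2//; exact: continuous_integrable_K.
Qed.

End RieszRepresentation.

(** The functional has to be given on all functions bounded on [K]; a positive
    functional on the continuous functions alone extends by
    [positive_extension]. *)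
Lemma riesz_representation (R : realType) (T : topologicalType)
    (T_nonempty : [set: T] !=set0) (K : set T) (Lam : (T -> R) -> R) :
    hausdorff_space T -> compact K -> positive_functional K Lam ->
  exists mu : {measure set (borel_space T_nonempty) -> \bar R},
    [/\ radon_measure mu, supported_in mu K &
        forall f : T -> R, continuous f ->
          mu.-integrable setT (EFin \o f) /\
          ((Lam f)%:E = \int[mu]_x (f x)%:E)%E].
Proof.
move=> hT cK Lam_pos.
have nu0 := functional_content_ge0 Lam_pos.
have nuU := functional_content_add Lam_pos.
have [mu muE] := borel_content_measure hT T_nonempty K nu0 nuU.
exists mu; split.
- exact: content_measure_radon muE.
- exact: content_measure_supported muE.
move=> f cf.
have mf : measurable_fun setT (f : borel_space T_nonempty -> R).
  exact: continuous_borel_measurable.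
have mCK : measurable (~` K : set (borel_space T_nonempty)).
  by apply: open_borel; apply: closed_openC; exact: compact_closed.
have CK0 := content_measure_setC hT cK nuU muE.
have ifK := continuous_integrable_K hT cK Lam_pos muE cf.
have ifT : mu.-integrable setT (EFin \o f).
  apply/(negligible_integrable mCK measurableT _ CK0); last by rewrite setTD setCK.
  exact/measurable_EFinP.
split=> //; rewrite (negligible_integral mCK measurableT ifT CK0) setTD setCK.
rewrite (functional_integralE hT cK Lam_pos muE cf) fineK//.
by apply: integrable_fin_num => //; apply: closed_borel; exact: compact_closed.
Qed.

(** * The character space *)

Section CharacterSpaceTopology.
Context {R : realType} {A : comAlgType R}.

Lemma algebra_hom_ext (alpha beta : algebra_hom A) :
  (forall a, eval_at a alpha = eval_at a beta) -> alpha = beta.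
Proof.
case: alpha beta => [f cf] [g cg] /= fg.
have {}fg : f = g by apply/funext => a; exact: fg.
rewrite {}fg in cf *; congr (GRing.LRMorphism.Pack _).
case: cf cg => [[c1] [c2] [c3]] [[d1] [d2] [d3]].
by rewrite (Prop_irrelevance c1 d1) (Prop_irrelevance c2 d2)
  (Prop_irrelevance c3 d3).
Qed.

Lemma hat_continuous (a : A) : continuous (hat a : character_space A -> R).
Proof.
move=> alpha.
have /cvg_sup/(_ a) : nbhs alpha --> (alpha : character_space A) by exact: cvg_id.
move=> h; apply: cvg_trans (@initial_continuous _ _ (eval_at a) alpha).
exact: cvg_app h.
Qed.

(** Distinct characters differ at some [a], and the continuous function [hat a]
    separates them. *)
Lemma character_space_hausdorff : hausdorff_space (character_space A).
Proof.
move=> alpha beta ab; apply: algebra_hom_ext => a.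
apply: (@norm_hausdorff _ R) => U V Ua Vb.
have := ab _ _ (@hat_continuous a alpha U Ua) (@hat_continuous a beta V Vb).
by move=> [x [Ux Vx]]; exists (hat a x).
Qed.

End CharacterSpaceTopology.

Theorem theorem2p7 (R : realType) (A : comAlgType R)
    (X_nonempty : [set: character_space A] !=set0)
    (K : set (character_space A)) (K_compact : compact K)
    (B : submodClosed A)
    (q_positive :
      exists2 q : A, q \in B & forall alpha, K alpha -> 0 < hat q alpha)
    (L : {scalar subspace_type B}) (L_positive : K_positive K L) :
  exists mu : {measure set (borel_space X_nonempty) -> \bar R},
    [/\ radon_measure mu, supported_in mu K &
        forall b : subspace_type B,
          mu.-integrable setT (fun alpha => (hat (\val b) alpha)%:E) /\
          ((L b)%:E = \int[mu]_alpha (hat (\val b) alpha)%:E)%E].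
Proof.
have [q qB q_gt0] := q_positive.
have [c c0 cq] : exists2 c : R, 0 < c & forall alpha, K alpha -> c <= hat q alpha.
  have [K0|K0] := pselect (K !=set0); last first.
    by exists 1 => // alpha Kalpha; exfalso; apply: K0; exists alpha.
  have [|alpha0 Kalpha0 qmin] := compact_EVT_min K0 K_compact (f := hat q).
    exact/continuous_subspaceT/hat_continuous.
  exists (hat q alpha0); first exact/q_gt0/set_mem.
  by move=> alpha Kalpha; apply: qmin; exact: mem_set.
have [||||||Lam Lam_pos LamE] := @positive_extension R (character_space A) K
    (subspace_type B) (fun b => hat (\val b)) L (Sub q qB) c.
- by move=> b b' alpha; exact: (rmorphD (alpha : algebra_hom A)).
- by move=> t b alpha; exact: (scalarZ (alpha : {lrmorphism A -> R | *%R})).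
- by move=> b; apply: bounded_on_continuous => //; exact: hat_continuous.
- exact: L_positive.
- exact: c0.
- by move=> alpha Kalpha; rewrite SubK cq.
have [mu [rmu smu muE]] := riesz_representation X_nonempty
  character_space_hausdorff K_compact Lam_pos.
exists mu; split=> // b; rewrite -LamE; apply: muE; exact: hat_continuous.
Qed.
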